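(* For any $\mathcal S\subseteq L^1$, the following are equivalent. (i) $\mathcal S$ is uniformly integrable. (ii) There exists $h\in\mathcal D_c$ such that $\rho_h(|X|)$ is bounded for $X\in\mathcal S$. (iii) There exists $h\in\mathcal D_c$ such that $\rho_h(X)$ and $\rho_h(-X)$ are bounded for $X\in\mathcal S$.
   Context: Fix an atomless probability space $(\Omega,\mathcal F,\mathbb P)$; random variables are real-valued and almost surely equal ones are identified; $L^1$ is the set of integrable random variables. A set $\mathcal S$ of random variables is uniformly integrable if $\sup_{X\in\mathcal S}\mathbb E[|X|\mathbf 1_{\{|X|>K\}}]\to0$ as $K\to\infty$. $\mathcal D$ is the set of (non-strictly) increasing functions $h:[0,1]\to[0,1]$ with $h(0)=0$, $h(1)=1$. $\mathcal D_c$ is the set of concave $h\in\mathcal D$ with $h(t)/t\to\infty$ as $t\downarrow0$. For concave $h\in\mathcal D$, the distortion risk measure $\rho_h:L^1\to(-\infty,\infty]$ is $$\rho_h(X)=\int_0^\infty h(\mathbb P(X>x))\,dx+\int_{-\infty}^0\big(h(\mathbb P(X>x))-1\big)\,dx .$$ ''Bounded for $X\in\mathcal S$'' means that the set of values over $X\in\mathcal S$ is a bounded subset of $\mathbb R$ (in particular the values are finite). *)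

(* Defs.v *)
From mathcomp Require Import all_boot all_order all_algebra.
From mathcomp Require Import all_classical all_reals all_analysis.

Set Implicit Arguments.
Unset Strict Implicit.
Unset Printing Implicit Defensive.

Import Order.TTheory GRing.Theory Num.Theory.
Import numFieldNormedType.Exports.

Local Open Scope classical_set_scope.
Local Open Scope ring_scope.

Definition atomless d (T : measurableType d) (R : realType)
    (P : probability T R) : Prop :=
  forall A : set T, measurable A -> (0 < P A)%E ->
    exists B : set T,
      [/\ measurable B, B `<=` A, (0 < P B)%E & (P B < P A)%E].

(* The supremum is taken in [0, +oo]: since ereal_sup set0 = -oo, the max with 0
   makes the empty family uniformly integrable and changes nothing otherwise. *)
Definition uniformly_integrable d (T : measurableType d) (R : realType)
    (P : probability T R) (S : set (T -> R)) : Prop :=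
  maxe 0%E (ereal_sup
    [set ('E_P[fun w => (`|X w| * \1_[set w' | K < `|X w'|] w)%R])%E | X in S])
  @[K --> +oo%R] --> 0%E.

(* A function h : [0,1] -> [0,1] is represented by a total function R -> R, of
   which only the values on [0,1] matter. *)
Definition distortion (R : realType) (h : R -> R) : Prop :=
  [/\ {in `[0, 1], forall t, 0 <= h t <= 1},
      {in `[0, 1] &, {homo h : s t / s <= t}},
      h 0 = 0 & h 1 = 1].

Definition concave_on (R : realType) (D : set R) (h : R -> R) : Prop :=
  convex_function (D : set R^o) (fun t => - h t).

Definition distortion_c (R : realType) (h : R -> R) : Prop :=
  [/\ distortion h, concave_on `[0, 1] h &
      h t / t @[t --> 0^'+] --> +oo%R].

(* For concave h in [distortion] and integrable X the second integral is finite,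
   so the sum is never of the form +oo - oo. *)
Definition rho d (T : measurableType d) (R : realType) (P : probability T R)
    (h : R -> R) (X : T -> R) : \bar R :=
  (\int[lebesgue_measure]_(x in `[0%R, +oo[)
      (h (fine (P [set w | (x < X w)%R])))%:E +
   \int[lebesgue_measure]_(x in `]-oo, 0%R])
      (h (fine (P [set w | (x < X w)%R])) - 1)%:E)%E.

(* In particular F is finite at every point of S. *)
Definition bounded_values (U : Type) (R : realType) (S : set U)
    (F : U -> \bar R) : Prop :=
  exists2 A : set R, bounded_set A & F @` S = EFin @` A.

(* Main.v *)
Require Import Defs.
From mathcomp Require Import all_boot all_order all_algebra.
From mathcomp Require Import all_classical all_reals all_analysis.
From mathcomp Require Import measurable_realfun.
From mathcomp Require Import ring lra.

(** Write [rho_h X = A(X) - B(X)] for the integrals over the two half-lines.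

    Uniform integrability gives levels [K n] with
    [E[|X|; |X| > K n] <= 2^-(n+1)] on [S]. Since
    [int_0^oo min(c, P(|X| > x)) dx <= c K + E[|X|; |X| > K]], the distortion
    [h t = (1 - sum_n w n) t + sum_n min(w n, t)], with [w n > 0] so small that
    [w n * K n <= 2^-(n+1)], works: its slope at 0 is infinite because at least
    [N] terms of the sum equal [t] for small [t].

    Conversely, by Markov's inequality [P(|X| > K)] is uniformly small for large
    [K], and then [t <= e h(t)] at [t = P(|X| > max(x, K))] bounds
    [E[|X|; |X| > K]] by [e rho_h(|X|)].

    Finally [B(X) <= E X^-] because [h t >= t]. If [rho_h(X)] and [rho_h(-X)]
    are at most [M] and [P(X > 0) <= 1/2] (else replace [X] by [-X]), concavity
    gives [A(X) >= 2 h(1/2) E X^+] with [2 h(1/2) > 1], and adding the two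
    bounds yields [(2 h(1/2) - 1) E X^+ <= 2 M]. Hence [A(X)] and [A(-X)] are
    bounded, and so is [rho_h(|X|)], which is at most their sum by subadditivity
    of [h]. *)

Set Implicit Arguments.
Unset Strict Implicit.
Unset Printing Implicit Defensive.

Import Order.TTheory GRing.Theory Num.Theory.
Import numFieldNormedType.Exports.
Local Open Scope classical_set_scope.
Local Open Scope ring_scope.

(** * Concave distortions *)

Section distortion_lemmas.
Context {R : realType}.
Implicit Types h : R -> R.

Lemma distortion_id : distortion (@id R).
Proof. by split=> // t; rewrite in_itv. Qed.

Lemma concave_onP h : concave_on `[0, 1] h <->
  forall l a b : R, 0 <= l <= 1 -> 0 <= a <= 1 -> 0 <= b <= 1 ->
    l * h a + (1 - l) * h b <= h (l * a + (1 - l) * b).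
Proof.
split=> [ch l a b /andP[l0 l1] a01 b01|ch t a b].
  have := ch (Itv01 l0 l1) a b; rewrite !inE/= !in_itv/= => /(_ a01 b01).
  rewrite !convRE/= /unstable.onem; lra.
rewrite !inE/= !in_itv/= => a01 b01; have := ch t%:num a b.
by rewrite ge0 le1 => /(_ isT a01 b01); rewrite !convRE/= /unstable.onem; lra.
Qed.

(** Concavity between 0 and 1, where [h] agrees with the identity. *)
Lemma concave_ge_id h : distortion h -> concave_on `[0, 1] h ->
  forall t : R, 0 <= t <= 1 -> t <= h t.
Proof.
move=> [_ _ h0 h1] /concave_onP ch t t01.
have := ch t 1 0 t01; rewrite h0 h1 lexx ler01 !mulr0 !addr0 !mulr1.
by move=> /(_ isT); rewrite lexx; apply.
Qed.

(** [s] is the combination of [t] and 0 with weight [s / t]; in other words, slopes of chords from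
    the origin decrease. *)
Lemma concave_ge_chord h : h 0 = 0 -> concave_on `[0, 1] h ->
  forall s t : R, 0 <= s <= t -> 0 < t <= 1 -> s / t * h t <= h s.
Proof.
move=> h0 /concave_onP ch s t /andP[s0 st] /andP[t0 t1].
have l01 : 0 <= s / t <= 1 by rewrite divr_ge0 ?(ltW t0)//= ler_pdivrMr// mul1r.
have := ch (s / t) t 0 l01.
rewrite h0 lexx ler01 (ltW t0) t1 !mulr0 !addr0 divfK ?gt_eqF//.
exact.
Qed.

(** Adds the chord inequalities of [s] and [t] below [s + t], whose weights sum to 1. *)
Lemma concave_subadditive h : h 0 = 0 -> concave_on `[0, 1] h ->
  forall s t : R, 0 <= s -> 0 <= t -> s + t <= 1 -> h (s + t) <= h s + h t.
Proof.
move=> h0 ch s t s0 t0 st1.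
have [st0|st0] := leP (s + t) 0.
  have -> : s = 0 by lra.
  have -> : t = 0 by lra.
  by rewrite addr0 h0 addr0.
have hs := @concave_ge_chord h h0 ch s (s + t).
have ht := @concave_ge_chord h h0 ch t (s + t).
have -> : h (s + t) = s / (s + t) * h (s + t) + t / (s + t) * h (s + t).
  by rewrite -mulrDl -mulrDl divff ?mul1r// gt_eqF.
by apply: lerD; [apply: hs|apply: ht]; lra.
Qed.

(** The infinite slope at 0 in product form, which also covers [t = 0]. *)
Lemma distortion_c_id_small h : distortion_c h -> forall e : R, 0 < e ->
  exists2 r : R, 0 < r & forall t : R, 0 <= t < r -> t <= e * h t.
Proof.
move=> [[_ _ h0 _] _ /cvgryPge hoo] e e0.
have /(_ e^-1) := hoo; rewrite near_withinE => -[r /= r0 H].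
exists r => // t /andP[t0 tr]; have [->|tn0] := eqVneq t 0.
  by rewrite h0 mulr0.
have {}t0 : 0 < t by rewrite lt_neqAle eq_sym tn0.
have := H t; rewrite /= sub0r normrN gtr0_norm// => /(_ tr t0).
by rewrite ler_pdivlMr// mulrC ler_pdivrMr// mulrC.
Qed.

(** Infinite slope puts [h] strictly above the diagonal near 0, and concavity carries this to 1/2.
    The factor [2 * h 2^-1 - 1] is thereby positive and can be divided by. *)
Lemma distortion_c_half h : distortion_c h -> 2^-1 < h 2^-1.
Proof.
move=> hc; have [dh ch _] := hc; have [_ _ h0 h1] := dh.
have [r r0 /= H] : exists2 r : R, 0 < r &
    forall t : R, 0 <= t < r -> t <= 2^-1 * h t.
  by apply: distortion_c_id_small => //; rewrite invr_gt0.
rewrite ltNge; apply/negP => half.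
(* The cap keeps 1/2 between [t] and 1. *)
pose t := Num.min (r / 2) (2^-1).
have t0 : 0 < t by rewrite lt_min invr_gt0 ltr0n andbT divr_gt0.
have t2 : t <= 2^-1 by rewrite ge_min lexx orbT.
have tr : t < r by rewrite gt_min ltr_pdivrMr// mulr_natr mulr2n ltrDl r0.
have ht : 2 * t <= h t.
  by have := H t; rewrite ltW// tr => /(_ isT); lra.
(* The chord of h from t to 1 lies strictly above the diagonal at 1/2. *)
pose l := 2^-1 / (1 - t).
have d0 : 0 < 1 - t by lra.
have l1 : l * (1 - t) = 2^-1 by rewrite /l divfK// gt_eqF.
have l01 : 0 <= l <= 1.
  by rewrite /l divr_ge0 ?(ltW d0)//= ler_pdivrMr//; lra.
have t01 : 0 <= t <= 1 by lra.
have /concave_onP /(_ l t 1 l01 t01) := ch.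
rewrite h1 lexx ler01 => /(_ isT).
have -> : l * t + (1 - l) * 1 = 2^-1 by nra.
have l0 : 0 < l by rewrite /l divr_gt0 // invr_gt0.
have : l * (2 * t) <= l * h t by rewrite ler_pM2l.
have : 0 < l * t by rewrite mulr_gt0.
nra.
Qed.

End distortion_lemmas.

(** * Tail probabilities and half-line integrals *)

Section tail.
Context d (T : measurableType d) (R : realType) (P : probability T R).
Implicit Types (X Y : T -> R) (h : R -> R).

Definition tail X (x : R) : R := fine (P [set w | x < X w]).

Definition upper h X : \bar R :=
  (\int[lebesgue_measure]_(x in `[0%R, +oo[) (h (tail X x))%:E)%E.

(** The sign is opposite to that in [rho], so that for a distortion both [upper] and [lower]
    integrate nonnegative functions. With [h = id] they are the expectations of the positive and
    negative parts of [X]. *)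
Definition lower h X : \bar R :=
  (\int[lebesgue_measure]_(x in `]-oo, 0%R]) (1 - h (tail X x))%:E)%E.

Lemma measurable_gt X x : measurable_fun setT X ->
  measurable [set w | x < X w].
Proof.
move=> mX; rewrite -[X in measurable X]setTI.
rewrite (_ : [set w | x < X w] = X @^-1` `]x, +oo[%classic); first exact: mX.
by apply/seteqP; split=> w /=; rewrite in_itv/= andbT.
Qed.

Lemma tail_ge0_le1 X x : measurable_fun setT X -> 0 <= tail X x <= 1.
Proof.
move=> mX; rewrite /tail fine_ge0//= -lee_fin fineK ?fin_num_measure//.
  exact/probability_le1/measurable_gt.
exact: measurable_gt.
Qed.

Lemma le_tail X Y x y : measurable_fun setT X -> measurable_fun setT Y ->
  (forall w, x < X w -> y < Y w) -> tail X x <= tail Y y.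
Proof.
move=> mX mY XY; have [mgX mgY] := (measurable_gt x mX, measurable_gt y mY).
by rewrite fine_le ?fin_num_measure// le_measure ?inE.
Qed.

Lemma tail_nonincreasing X : measurable_fun setT X ->
  nonincreasing_fun (tail X).
Proof. by move=> mX x y xy; apply: le_tail => // w; exact: le_lt_trans. Qed.

(** For [x >= 0] the events X > x and -X > x are disjoint. *)
Lemma tail_norm X x : measurable_fun setT X -> 0 <= x ->
  tail (fun w => `|X w|) x = tail X x + tail (fun w => - X w) x.
Proof.
move=> mX x0; rewrite /tail -fineD ?fin_num_measure//; last 2 first.
- exact: measurable_gt.
- exact/measurable_gt/measurableT_comp.
rewrite -measureU//; last 3 first.
- exact: measurable_gt.
- exact/measurable_gt/measurableT_comp.
- by apply/seteqP; split=> // w /= [? ?]; lra.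
congr (fine (P _)); apply/seteqP; split=> w /=; rewrite ltrNr; last first.
  by case; rewrite ltr_normr// => ?; apply/orP; [left|right]; lra.
by rewrite ltr_normr => /orP[]; [left|right; lra].
Qed.

Lemma distortion_tail h X x : distortion h -> measurable_fun setT X ->
  0 <= h (tail X x) <= 1.
Proof.
by move=> [h01 _ _ _] mX; apply: h01; rewrite in_itv/=; exact: tail_ge0_le1.
Qed.

Lemma le_distortion_tail h X Y x y : distortion h ->
  measurable_fun setT X -> measurable_fun setT Y ->
  tail X x <= tail Y y -> h (tail X x) <= h (tail Y y).
Proof.
by move=> [_ hm _ _] mX mY; apply: hm; rewrite in_itv/=; exact: tail_ge0_le1.
Qed.

(** Monotonicity suffices; [h] may jump. *)
Lemma measurable_distortion_tail h X D : distortion h ->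
  measurable_fun setT X -> measurable D ->
  measurable_fun D (fun x => h (tail X x)).
Proof.
move=> dh mX mD; apply: nonincreasing_measurable => // x y xy.
by apply: le_distortion_tail => //; exact: tail_nonincreasing.
Qed.

Lemma measurable_tail X D : measurable_fun setT X -> measurable D ->
  measurable_fun D (tail X).
Proof. by move=> mX; exact: measurable_distortion_tail distortion_id mX. Qed.

(** The layer-cake formula. *)
Lemma expectation_upper X : measurable_fun setT X -> (forall w, 0 <= X w) ->
  ('E_P[X] = upper id X)%E.
Proof.
move=> mX X0; pose Y : {RV P >-> R} := mfun_Sub (mem_set mX : X \in mfun).
rewrite -[X in LHS]/(Y : T -> R) ge0_expectation_ccdf//.
apply: eq_integral => x _; rewrite /tail fineK; last first.
  by rewrite fin_num_measure//; exact: measurable_gt.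
congr (P _); apply/seteqP; split=> w /=; by rewrite in_itv/= andbT.
Qed.

Lemma eq_upper h X Y : (forall x, 0 <= x -> tail X x = tail Y x) ->
  upper h X = upper h Y.
Proof.
move=> XY; apply: eq_integral => x; rewrite inE/= in_itv/= andbT => x0.
by rewrite XY.
Qed.

(** Both sides are the expectation of the negative part [Z]: one by the layer-cake formula, the
    other through the distribution function of [- Z]. *)
Lemma lower_id X : measurable_fun setT X ->
  lower id X = upper id (fun w => - X w).
Proof.
move=> mX; have mNX : measurable_fun setT (fun w => - X w).
  exact: measurableT_comp.
pose Z w := Num.max (- X w) 0.
have mZ : measurable_fun setT Z by exact: measurable_maxr.
have Z0 w : 0 <= Z w by rewrite le_max lexx orbT.
have -> : upper id (fun w => - X w) = ('E_P[Z])%E.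
  rewrite expectation_upper//; apply: eq_upper => x x0; congr fine; congr (P _).
  by apply/seteqP; split=> w /=; rewrite lt_max [x < 0]ltNge x0 orbF.
have mNZ : measurable_fun setT (fun w => - Z w) by exact: measurableT_comp.
pose Y : {RV P >-> R} := mfun_Sub (mem_set mNZ : _ \in mfun).
have YE w : Y w = - Z w by [].
have : ('E_P[Y] = - 'E_P[Z])%E.
  by rewrite unlock -integral_ge0N// => w _; rewrite lee_fin.
rewrite le0_expectation_cdf; last by move=> w; rewrite YE oppr_le0.
(* The endpoint 0 is removed because the distribution function of [- Z] is 1 there, whatever P(X <=
   0) is. *)
move=> /oppe_inj <-; rewrite /lower -integral_itv_bndo_bndc; last first.
  apply/measurable_EFinP/measurable_funB => //.
  exact: measurable_tail.
apply: eq_integral => x; rewrite inE/= in_itv/= => x0.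
transitivity (P [set w | X w <= x]); last first.
  congr (P _); apply/seteqP; split=> w /=; rewrite in_itv/= lerNl le_max.
    by move=> Xx; rewrite lerN2 Xx.
  by rewrite lerN2 oppr_le0 [0 <= x]leNgt x0 orbF.
rewrite EFinB /tail fineK ?fin_num_measure//; last exact: measurable_gt.
rewrite (_ : [set w | X w <= x] = ~` [set w | x < X w]); last first.
  by apply/seteqP; split=> w /=; rewrite leNgt; move/negP.
by rewrite probability_setC//; exact: measurable_gt.
Qed.

End tail.

Lemma bounded_valuesP (U : Type) (R : realType) (S : set U) (F : U -> \bar R) :
  bounded_values S F <->
  exists M : R, forall X, S X -> (`|F X| <= M%:E)%E.
Proof.
split=> [[A [M [_ AM]] FA]|[M FM]].
  (* [bounded_set] only promises the bound for reals strictly above [M]. *)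
  exists (M + 1) => X SX; have : (F @` S) (F X) by exists X.
  rewrite FA => -[r Ar <-]; rewrite abse_EFin lee_fin.
  by apply: AM => //; rewrite ltrDl.
have Ffin X : S X -> F X = (fine (F X))%:E.
  move=> SX; rewrite fineK// fin_num_abs.
  exact: le_lt_trans (FM _ SX) (ltry _).
exists ((fine \o F) @` S); last first.
  rewrite eqEsubset; split=> [_ [X SX <-]|_ [_ [X SX <-] <-]].
    by exists (fine (F X)); [exists X|rewrite -Ffin].
  by exists X => //; exact: Ffin.
exists M; split; first exact: num_real.
move=> r Mr _ [X SX <-] /=; rewrite (le_trans _ (ltW Mr))//.
by have := FM X SX; rewrite {1}Ffin// abse_EFin lee_fin.
Qed.

(** * The risk measure in terms of [upper] and [lower] *)

Section rho.
Context d (T : measurableType d) (R : realType) (P : probability T R).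
Implicit Types (X Y : T -> R) (h : R -> R).
Local Notation tail := (tail P).
Local Notation upper := (upper P).
Local Notation lower := (lower P).

Lemma Lfun1_measurable X : X \in Lfun P 1 -> measurable_fun setT X.
Proof. by move=> /sub_Lfun_mfun; rewrite inE. Qed.

Lemma upper_ge0 h X : distortion h -> measurable_fun setT X ->
  (0 <= upper h X)%E.
Proof.
move=> dh mX; apply: integral_ge0 => x _; rewrite lee_fin.
by have /andP[] := distortion_tail P x dh mX.
Qed.

Lemma lower_ge0 h X : distortion h -> measurable_fun setT X ->
  (0 <= lower h X)%E.
Proof.
move=> dh mX; apply: integral_ge0 => x _; rewrite lee_fin subr_ge0.
by have /andP[] := distortion_tail P x dh mX.
Qed.

Lemma le_upper h k X Y : distortion h -> distortion k ->
  measurable_fun setT X -> measurable_fun setT Y ->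
  (forall x, 0 <= x -> h (tail X x) <= k (tail Y x)) ->
  (upper h X <= upper k Y)%E.
Proof.
move=> dh dk mX mY hk; apply: ge0_le_integral => //=.
- by move=> x _; rewrite lee_fin; have /andP[] := distortion_tail P x dh mX.
- by apply/measurable_EFinP; exact: measurable_distortion_tail.
- by apply/measurable_EFinP; exact: measurable_distortion_tail.
- by move=> x; rewrite in_itv/= andbT lee_fin; exact: hk.
Qed.

Lemma le_upper_norm h X : distortion h -> measurable_fun setT X ->
  (upper h X <= upper h (fun w => `|X w|)%R)%E.
Proof.
move=> dh mX; have mXn : measurable_fun setT (fun w => `|X w|).
  exact: measurableT_comp.
apply: le_upper => // x x0; apply: le_distortion_tail => //.
by apply: le_tail => // w /lt_le_trans; apply; exact: ler_norm.
Qed.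

Lemma upper_id_le h X : distortion h -> concave_on `[0, 1] h ->
  measurable_fun setT X -> (upper id X <= upper h X)%E.
Proof.
move=> dh ch mX; apply: le_upper => //; first exact: distortion_id.
by move=> x x0; apply: concave_ge_id => //; exact: tail_ge0_le1.
Qed.

(** With [lower_id], this bounds [lower h X] by the expectation of the negative part, so for
    integrable [X] only [upper] can be infinite. *)
Lemma lower_le_id h X : distortion h -> concave_on `[0, 1] h ->
  measurable_fun setT X -> (lower h X <= lower id X)%E.
Proof.
move=> dh ch mX; apply: ge0_le_integral; rewrite //=.
- move=> x _; rewrite lee_fin subr_ge0.
  by have /andP[] := distortion_tail P x dh mX.
- apply/measurable_EFinP/measurable_funB => //.
  exact: measurable_distortion_tail.
- by apply/measurable_EFinP/measurable_funB => //; exact: measurable_tail.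
- move=> x _; rewrite lee_fin lerB//; apply: concave_ge_id => //.
  exact: tail_ge0_le1.
Qed.

Lemma rhoE h X : distortion h -> measurable_fun setT X ->
  rho P h X = (upper h X - lower h X)%E.
Proof.
move=> dh mX; congr (_ + _)%E; rewrite -integral_ge0N; last first.
  move=> x _; rewrite lee_fin subr_ge0.
  by have /andP[] := distortion_tail P x dh mX.
by apply: eq_integral => x _; rewrite -EFinN opprB.
Qed.

Lemma rho_ge0 h X : distortion h -> measurable_fun setT X ->
  (forall w, 0 <= X w) -> rho P h X = upper h X.
Proof.
move=> dh mX X0; rewrite rhoE// [lower h X](_ : _ = 0%E) ?sube0//.
(* Below 0 the tail is 1, but at 0 it may be smaller, hence the open interval. *)
rewrite /lower -integral_itv_bndo_bndc; last first.
  apply/measurable_EFinP/measurable_funB => //.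
  exact: measurable_distortion_tail.
apply: integral0_eq => x; rewrite /= in_itv/= => x0.
rewrite /tail [X in P X](_ : _ = setT); last first.
  by apply/seteqP; split=> w //= _; exact: lt_le_trans (X0 w).
by rewrite probability_setT/=; have [_ _ _ ->] := dh; rewrite subrr.
Qed.

Lemma upper_norm_le h X : distortion h -> concave_on `[0, 1] h ->
  measurable_fun setT X ->
  (upper h (fun w => `|X w|)%R <= upper h X + upper h (fun w => - X w)%R)%E.
Proof.
move=> dh ch mX; have mNX : measurable_fun setT (fun w => - X w).
  exact: measurableT_comp.
have mXn : measurable_fun setT (fun w => `|X w|) by exact: measurableT_comp.
rewrite /upper -ge0_integralD//; first last.
- by apply/measurable_EFinP; exact: measurable_distortion_tail.
- by move=> x _; rewrite lee_fin; have /andP[] := distortion_tail P x dh mNX.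
- by apply/measurable_EFinP; exact: measurable_distortion_tail.
- by move=> x _; rewrite lee_fin; have /andP[] := distortion_tail P x dh mX.
apply: ge0_le_integral => //=.
- by move=> x _; rewrite lee_fin; have /andP[] := distortion_tail P x dh mXn.
- by apply/measurable_EFinP; exact: measurable_distortion_tail.
- by apply: emeasurable_funD;
    by apply/measurable_EFinP; exact: measurable_distortion_tail.
- move=> x; rewrite in_itv/= andbT lee_fin => x0; rewrite tail_norm//.
  apply: concave_subadditive => //; first by have [] := dh.
  + by have /andP[] := tail_ge0_le1 P x mX.
  + by have /andP[] := tail_ge0_le1 P x mNX.
  + by rewrite -tail_norm//; have /andP[] := tail_ge0_le1 P x mXn.
Qed.

Lemma upper_id_fin_num X : X \in Lfun P 1 -> upper id X \is a fin_num.
Proof.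
move=> XL1; have mX := Lfun1_measurable XL1; have did := @distortion_id R.
have mXn : measurable_fun setT (fun w => `|X w|) by exact: measurableT_comp.
rewrite ge0_fin_numE; last exact: upper_ge0.
apply: le_lt_trans (le_upper_norm did mX) _.
rewrite -expectation_upper// -ge0_fin_numE; last exact: expectation_ge0.
exact/expectation_fin_num/Lfun_norm.
Qed.

(** [rho] is a difference of two nonnegative terms, each at most [upper h] of |X|; for [lower] the
    chain passes through E X^- and [upper h] of -X. *)
Lemma le_abse_rho h X : distortion h -> concave_on `[0, 1] h ->
  measurable_fun setT X ->
  (`|rho P h X| <= rho P h (fun w => `|X w|)%R)%E.
Proof.
move=> dh ch mX; have mXn : measurable_fun setT (fun w => `|X w|).
  exact: measurableT_comp.
have mNX : measurable_fun setT (fun w => - X w) by exact: measurableT_comp.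
rewrite [leRHS]rho_ge0// rhoE//.
have lowerX : (lower h X <= upper h (fun w => `|X w|)%R)%E.
  rewrite (le_trans (lower_le_id dh ch mX))// lower_id//.
  rewrite (le_trans (upper_id_le dh ch mNX))//.
  rewrite (le_trans (le_upper_norm dh mNX))//.
  by under [fun w => `|- X w|]funext do rewrite normrN.
have := upper_ge0 dh mX; have := lower_ge0 dh mX.
have := le_upper_norm dh mX; move: lowerX.
move: (upper h X) (lower h X) (upper h _) => [a||] [b||] [c||]//=;
  rewrite ?leey// !lee_fin => ? ? ? ?; rewrite ler_norml; lra.
Qed.

End rho.

(** * Uniform integrability from bounded risk *)

Section uniform_integrability.
Context d (T : measurableType d) (R : realType) (P : probability T R).
Implicit Types (X Y : T -> R) (h : R -> R) (S : set (T -> R)).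
Local Notation tail := (tail P).
Local Notation upper := (upper P).
Local Notation lower := (lower P).

(** Convertible to the integrand in [uniformly_integrable]. *)
Definition truncate X K (w : T) : R := `|X w| * \1_[set w' | K < `|X w'|] w.

Lemma truncate_ge0 X K w : 0 <= truncate X K w.
Proof. by rewrite /truncate mulr_ge0. Qed.

Lemma measurable_truncate X K : measurable_fun setT X ->
  measurable_fun setT (truncate X K).
Proof.
move=> mX; have mXn : measurable_fun setT (fun w => `|X w|).
  exact: measurableT_comp.
by apply: measurable_funM => //; exact/measurable_indic/measurable_gt.
Qed.

Lemma uniformly_integrableP S : uniformly_integrable P S <->
  forall e : R, 0 < e ->
    \forall K \near +oo, forall X, S X -> ('E_P[truncate X K] <= e%:E)%E.
Proof.
split=> [/fine_cvgP[Sfin /cvgr0_norm_le S0] e e0|H].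
  have {}S0 := S0 e e0; near=> K => X SX.
  have : (maxe 0 (ereal_sup [set 'E_P[truncate X K] | X in S]) <= e%:E)%E.
    rewrite -[leLHS]fineK; last by near: K.
    by rewrite lee_fin (le_trans (ler_norm _))//; near: K.
  rewrite ge_max => /andP[_]; apply: le_trans.
  by apply: ereal_sup_ubound; exists X.
have sup_le (e K : R) : (forall X, S X -> ('E_P[truncate X K] <= e%:E)%E) ->
    0 <= e ->
    (0 <= maxe 0 (ereal_sup [set 'E_P[truncate X K] | X in S]) <= e%:E)%E.
  move=> HK e0; rewrite le_max lexx/= ge_max lee_fin e0/=.
  by apply: ge_ereal_sup => _ [X SX <-]; exact: HK.
apply/fine_cvgP; split.
  (* The bound with [e = 1] gives eventual finiteness. *)
  near=> K; have /andP[s0 s1] : (0 <= maxe 0 (ereal_sup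
      [set 'E_P[truncate X K] | X in S]) <= 1%:E)%E.
    by apply: sup_le => //; near: K; exact: H.
  by rewrite ge0_fin_numE// (le_lt_trans s1)// ltry.
apply/cvgr0Pnorm_le => e e0; near=> K.
have /andP[s0 s1] : (0 <= maxe 0 (ereal_sup
    [set 'E_P[truncate X K] | X in S]) <= e%:E)%E.
  by apply: sup_le => //; [near: K; exact: H|exact: ltW].
rewrite /= ger0_norm ?fine_ge0// -lee_fin fineK//.
by rewrite ge0_fin_numE// (le_lt_trans s1)// ltry.
Unshelve. all: by end_near. Qed.

Lemma tail_truncate_le X K x : measurable_fun setT X -> 0 <= x ->
  tail (truncate X K) x <= tail (fun w => `|X w|) (Num.max x K).
Proof.
move=> mX x0; apply: le_tail => [||w].
- exact: measurable_truncate.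
- exact: measurableT_comp.
rewrite /truncate indicE gt_max; have [Kw|Kw] := boolP (K < `|X w|).
  by rewrite mem_set// mulr1 andbT.
by rewrite memNset ?mulr0 ?ltNge ?x0//; apply/negP.
Qed.

Lemma markov_tail X K : measurable_fun setT X -> 0 < K ->
  (K%:E * (tail (fun w => `|X w|) K)%:E <= 'E_P[(fun w => `|X w|)%R])%E.
Proof.
move=> mX K0; have mXn : measurable_fun setT (fun w => `|X w|).
  exact: measurableT_comp.
pose Y : {RV P >-> R} := mfun_Sub (mem_set mX : _ \in mfun).
have := @markov _ _ _ P Y id K K0 (@measurable_id _ _ _) (fun _ => id).
move=> /(_ (fun _ _ _ _ => id)); apply: le_trans.
rewrite fineK ?fin_num_measure//; last exact: measurable_gt.
apply: lee_pmul => //; first by rewrite lee_fin ltW.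
apply: le_measure; rewrite ?inE//.
- exact: measurable_gt.
- by rewrite -[X in measurable X]setTI; apply: emeasurable_fun_c_infty => //;
    apply/measurable_EFinP/measurableT_comp.
- by move=> w /=; rewrite lee_fin => /ltW.
Qed.

Lemma upper_bounded_uniformly_integrable S h : distortion_c h ->
  (forall X, S X -> measurable_fun setT X) ->
  (exists M : R, forall X, S X ->
    (upper h (fun w => `|X w|)%R <= M%:E)%E) ->
  uniformly_integrable P S.
Proof.
move=> hc mS [M HM]; apply/uniformly_integrableP => e e0.
have [dh ch _] := hc.
(* A positive bound, since [M] may be negative when [S] is empty. *)
pose M' := `|M| + 1.
have M'0 : 0 < M' by rewrite ltr_wpDl.
have [r r0 Hr] := distortion_c_id_small hc (divr_gt0 e0 M'0).
near=> K => X SX; have mX := mS X SX.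
have K0 : 0 < K by near: K; exact: nbhs_pinfty_gt.
have mXn : measurable_fun setT (fun w => `|X w|) by exact: measurableT_comp.
have uM : (upper h (fun w => `|X w|)%R <= M'%:E)%E.
  rewrite (le_trans (HM X SX))// lee_fin /M' ler_wpDr//.
  by rewrite (le_trans (ler_norm _)) //.
(* Markov with E|X| <= M' gives a tail of at most M'/K, so K > M'/r suffices, uniformly in [X]. *)
have tailK : tail (fun w => `|X w|) K < r.
  have : (K%:E * (tail (fun w => `|X w|) K)%:E <= M'%:E)%E.
    rewrite (le_trans (markov_tail mX K0))// expectation_upper//.
    exact: le_trans (upper_id_le P dh ch mXn) uM.
  rewrite -EFinM lee_fin mulrC -ler_pdivlMr//; move/le_lt_trans; apply.
  rewrite ltr_pdivrMr// mulrC -ltr_pdivrMr//.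
  by near: K; apply: nbhs_pinfty_gt; rewrite num_real.
have mY := measurable_truncate K mX.
rewrite expectation_upper//; last by move=> w; exact: truncate_ge0.
(* Pointwise, the truncated tail at [x] is at most the tail of |X| at max(x, K). This is below [r],
   so [Hr] applies, and lowering the level to [x] only increases [h]. *)
have step : (upper id (truncate X K) <=
    (e / M')%:E * upper h (fun w => `|X w|)%R)%E.
  rewrite -ge0_integralZl_EFin//; last 3 first.
  - by move=> x _; rewrite lee_fin; have /andP[] := distortion_tail P x dh mXn.
  - by apply/measurable_EFinP; exact: measurable_distortion_tail.
  - by rewrite divr_ge0// ltW.
  apply: ge0_le_integral => //=.
  - by move=> x _; rewrite lee_fin; have /andP[] := tail_ge0_le1 P x mY.
  - by apply/measurable_EFinP; exact: measurable_tail.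
  - apply/measurable_EFinP; apply: measurable_funM => //.
    by exact: measurable_distortion_tail.
  - move=> x; rewrite in_itv/= andbT => x0; rewrite lee_fin.
    have t01 := tail_ge0_le1 P (Num.max x K) mXn.
    rewrite (le_trans (tail_truncate_le K mX x0))//.
    rewrite (le_trans (Hr _ _))//.
      have /andP[-> _] /= := t01; apply: le_lt_trans tailK.
      by apply: tail_nonincreasing => //; rewrite le_max lexx orbT.
    rewrite ler_pM2l ?divr_gt0//; apply: le_distortion_tail => //.
    by apply: tail_nonincreasing => //; rewrite le_max lexx.
rewrite (le_trans step)//.
rewrite (@le_trans _ _ ((e / M')%:E * M'%:E)%E)//.
  by apply: lee_pmul => //; [rewrite lee_fin divr_ge0// ltW|exact: upper_ge0].
by rewrite -EFinM divfK// gt_eqF.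
Unshelve. all: by end_near. Qed.

Lemma two_sided_upper_bound_half h X (M : R) : distortion_c h ->
  X \in Lfun P 1 -> tail X 0 <= 2^-1 ->
  (rho P h X <= M%:E)%E -> (rho P h (fun w => - X w)%R <= M%:E)%E ->
  (upper h (fun w => `|X w|)%R <=
   (3 * M + 2 * (2 * M / (2 * h 2^-1 - 1)))%:E)%E.
Proof.
move=> hc XL1 half; have [dh ch _] := hc; have mX := Lfun1_measurable XL1.
have mNX : measurable_fun setT (fun w => - X w) by exact: measurableT_comp.
have NXL1 : (fun w => - X w) \in Lfun P 1 by exact: rpredNr.
have kap := distortion_c_half hc.
rewrite !rhoE//.
have la : (lower h X <= upper id (fun w => - X w)%R)%E.
  by rewrite -lower_id//; exact: lower_le_id.
have lb : (lower h (fun w => - X w)%R <= upper id X)%E.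
  rewrite (le_trans (lower_le_id P dh ch mNX))// lower_id//.
  by under [fun w => - - X w]funext do rewrite opprK.
have ub := upper_id_le P dh ch mNX.
(* The tails at [x >= 0] are at most 1/2, so the chord of [h] over [0, 1/2] bounds [h] from
   below. *)
have ua : ((2 * h 2^-1)%:E * upper id X <= upper h X)%E.
  rewrite -ge0_integralZl_EFin//; last 3 first.
  - by move=> x _; rewrite lee_fin; have /andP[] := tail_ge0_le1 P x mX.
  - by apply/measurable_EFinP; exact: measurable_tail.
  - by lra.
  apply: ge0_le_integral => //=.
  - move=> x _; rewrite lee_fin mulr_ge0//; first by lra.
    by have /andP[] := tail_ge0_le1 P x mX.
  - apply/measurable_EFinP; apply: measurable_funM => //.
    exact: measurable_tail.
  - by apply/measurable_EFinP; exact: measurable_distortion_tail.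
  - move=> x; rewrite in_itv/= andbT => x0; rewrite lee_fin.
    have /andP[t0 _] := tail_ge0_le1 P x mX.
    have th : tail X x <= 2^-1.
      by rewrite (le_trans _ half)//; exact: tail_nonincreasing.
    have h0 : h 0 = 0 by have [] := dh.
    have := @concave_ge_chord _ h h0 ch (tail X x) 2^-1.
    rewrite t0 th => /(_ isT); rewrite invrK; lra.
have := upper_norm_le P dh ch mX.
have := lower_ge0 P dh mX; have := lower_ge0 P dh mNX.
have := upper_ge0 P (@distortion_id R) mX.
have := upper_ge0 P (@distortion_id R) mNX.
have := upper_id_fin_num XL1; have := upper_id_fin_num NXL1.
move: la lb ub ua.
move: (upper h X) (lower h X) (upper h (fun w => - X w)).
move: (lower h (fun w => - X w)) (upper h (fun w => `|X w|)).
move: (upper id X) (upper id (fun w => - X w)).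
(* Here a = E X^+ and b = E X^- are finite by integrability; they dominate the [lower] terms, and
   the two risk bounds then make the [upper] terms finite. *)
move=> [a||] [b||]// [B2||] [U||] [A1||]//[B1||]//[A2||]//=;
  rewrite ?leNye//.
rewrite -?EFinM -?EFinD ?leye_eq ?lee_fin//.
set c := 2 * M / _.
have cE : c * (2 * h 2^-1 - 1) = 2 * M by rewrite /c divfK// gt_eqF//; lra.
move=> B1b B2a bA2 kA1 _ _ b0 a0 B20 B10 UA r1 r2.
(* 2 h(1/2) a <= A1 <= M + b and b <= A2 <= M + B2 <= M + a. *)
have ac : a <= c.
  rewrite -(@ler_pM2r _ (2 * h 2^-1 - 1)); last by lra.
  by rewrite cE; lra.
(* A2 <= M + c and A1 <= M + b <= 2 M + c, whose sum is 3 M + 2 c. *)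
lra.
Qed.

End uniform_integrability.

(** * A distortion with infinite slope built from summable weights *)

Section distortion_of_weights.
Context {R : realType} (w : nat -> R).
Hypothesis w_gt0 : forall n, 0 < w n.
Hypothesis w_sum : (\sum_(n <oo) (w n)%:E <= 1)%E.

Let s (t : R) : R := fine (\sum_(n <oo) (Num.min (w n) t)%:E)%E.

Let min_ge0 n (t : R) : 0 <= t -> (0 <= (Num.min (w n) t)%:E)%E.
Proof. by move=> t0; rewrite lee_fin le_min t0 ltW. Qed.

Let s_le (t : R) : 0 <= t -> (\sum_(n <oo) (Num.min (w n) t)%:E <= 1)%E.
Proof.
move=> t0; apply: le_trans w_sum; apply: lee_nneseries => n *.
  exact: min_ge0.
by rewrite lee_fin ge_min lexx.
Qed.

Let sE (t : R) : 0 <= t -> (s t)%:E = (\sum_(n <oo) (Num.min (w n) t)%:E)%E.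
Proof.
move=> t0; rewrite fineK// ge0_fin_numE ?(le_lt_trans (s_le t0)) ?ltry//.
by apply: nneseries_ge0 => n _ _; exact: min_ge0.
Qed.

Let s_ge0 (t : R) : 0 <= t -> 0 <= s t.
Proof.
move=> t0; rewrite -lee_fin sE//.
by apply: nneseries_ge0 => n *; exact: min_ge0.
Qed.

Let s_le1 (t : R) : 0 <= t -> s t <= 1.
Proof. by move=> t0; rewrite -lee_fin sE//; exact: s_le. Qed.

Let s_nondecreasing (t u : R) : 0 <= t -> t <= u -> s t <= s u.
Proof.
move=> t0 tu; have u0 := le_trans t0 tu.
rewrite -lee_fin !sE//; apply: lee_nneseries => n *; first exact: min_ge0.
by rewrite lee_fin le_min !ge_min lexx tu orbT.
Qed.

Let s0 : s 0 = 0.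
Proof.
rewrite /s eseries0// => n _ _; congr (_%:E).
by apply/min_idPr; exact: ltW.
Qed.

Let s_concave (l a b : R) : 0 <= l <= 1 -> 0 <= a -> 0 <= b ->
  l * s a + (1 - l) * s b <= s (l * a + (1 - l) * b).
Proof.
move=> /andP[l0 l1] a0 b0; have l'0 : 0 <= 1 - l by rewrite subr_ge0.
have c0 : 0 <= l * a + (1 - l) * b by rewrite addr_ge0// mulr_ge0.
rewrite -lee_fin EFinD !EFinM !sE//.
rewrite -!nneseriesZl; [|by move=> n _; exact: min_ge0..].
rewrite -nneseriesD; last 2 first.
- by move=> n _ _; rewrite -EFinM lee_fin mulr_ge0// -lee_fin min_ge0.
- by move=> n _ _; rewrite -EFinM lee_fin mulr_ge0// -lee_fin min_ge0.
apply: lee_nneseries => n *.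
  by rewrite -!EFinM -EFinD lee_fin addr_ge0// mulr_ge0// -lee_fin min_ge0.
rewrite -!EFinM -EFinD lee_fin le_min; apply/andP; split.
  rewrite -[leRHS](_ : l * w n + (1 - l) * w n = _); last by ring.
  by apply: lerD; apply: ler_wpM2l => //; rewrite ge_min lexx.
by apply: lerD; apply: ler_wpM2l => //; rewrite ge_min lexx orbT.
Qed.

Let s_steep (N : nat) (t : R) : 0 <= t -> (forall n, (n < N)%N -> t <= w n) ->
  N%:R * t <= s t.
Proof.
move=> t0 tw; rewrite -lee_fin sE//.
apply: le_trans (@nneseries_lim_ge _ _ xpredT 0 N _); last first.
  by move=> n _ _; exact: min_ge0.
rewrite (_ : (\sum_(0 <= i < N) (Num.min (w i) t)%:E =
              \sum_(0 <= i < N) t%:E)%E); last first.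
  apply: eq_big_nat => n /andP[_ nN]; congr (_%:E).
  by apply/min_idPr; exact: tw.
by rewrite sumEFin lee_fin sumr_const_nat subn0 mulr_natl.
Qed.

(* The linear part normalizes the value at 1. *)
Definition weight_distortion (t : R) : R := (1 - s 1) * t + s t.

Lemma weight_distortion_c : distortion_c weight_distortion.
Proof.
have s1 : 0 <= 1 - s 1 by rewrite subr_ge0 s_le1.
have h0 : weight_distortion 0 = 0.
  by rewrite /weight_distortion s0 mulr0 addr0.
have h1 : weight_distortion 1 = 1.
  by rewrite /weight_distortion mulr1 subrK.
have hm t u : 0 <= t -> t <= u -> weight_distortion t <= weight_distortion u.
  by move=> t0 tu; rewrite lerD ?ler_wpM2l ?s_nondecreasing.
split.
- split=> // [t|t u].
    rewrite in_itv/= => /andP[t0 t1]; rewrite -{1}h0 -h1.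
    by rewrite !hm.
  by rewrite !in_itv/= => /andP[t0 _] _; exact: hm.
- apply/concave_onP => l a b l01 /andP[a0 _] /andP[b0 _].
  by have := s_concave l01 a0 b0; rewrite /weight_distortion; lra.
(* Below the first [N] weights, [s t >= N%:R * t] with [N%:R >= A]. *)
- apply/cvgryPge => A; pose N := (Num.truncn `|A|).+1.
  have AN : A <= N%:R.
    by rewrite (le_trans (ler_norm _))// ltW// truncnS_gt.
  have : \forall t \near 0^'+, forall n : 'I_N, t <= w n.
    by apply: filter_forall => n; exact: nbhs_right_le.
  move=> H; near=> t.
  have t0 : 0 < t by near: t; exact: nbhs_right_gt.
  have tw : forall n : 'I_N, t <= w n by near: t; exact: H.
  rewrite ler_pdivlMr// (le_trans (ler_wpM2r (ltW t0) AN))//.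
  rewrite (le_trans (@s_steep N t (ltW t0) _))//.
    by move=> n nN; exact: (tw (Ordinal nN)).
  by rewrite /weight_distortion lerDr mulr_ge0// ltW.
Unshelve. all: by end_near. Qed.

Lemma weight_distortion_le (t : R) : 0 <= t ->
  ((weight_distortion t)%:E <=
   t%:E + \sum_(n <oo) (Num.min (w n) t)%:E)%E.
Proof.
move=> t0; rewrite -sE// -EFinD lee_fin /weight_distortion lerD2r ler_piMl//.
by rewrite lerBlDr lerDl s_ge0.
Qed.

End distortion_of_weights.

(** * Integral bounds in both directions *)

Section bounds.
Context d (T : measurableType d) (R : realType) (P : probability T R).
Implicit Types (X Y : T -> R) (h : R -> R) (S : set (T -> R)).
Local Notation tail := (tail P).
Local Notation upper := (upper P).

(** P(X > 0) and P(-X > 0) sum to at most 1, so one is at most 1/2; the remaining assumptions and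
    the bound are symmetric in [X] and -X. *)
Lemma two_sided_upper_bound h X (M : R) : distortion_c h ->
  X \in Lfun P 1 ->
  (rho P h X <= M%:E)%E -> (rho P h (fun w => - X w)%R <= M%:E)%E ->
  (upper h (fun w => `|X w|)%R <=
   (3 * M + 2 * (2 * M / (2 * h 2^-1 - 1)))%:E)%E.
Proof.
move=> hc XL1 r1 r2; have mX := Lfun1_measurable XL1.
have [half|half] := leP (tail X 0) 2^-1.
  exact: two_sided_upper_bound_half.
under [fun w => `|X w|]funext do rewrite -normrN.
apply: two_sided_upper_bound_half => //; first exact: rpredNr.
  have := tail_norm P mX (lexx 0).
  have mXn : measurable_fun setT (fun w => `|X w|) by exact: measurableT_comp.
  by have := tail_ge0_le1 P 0 mXn; lra.
by under [fun w => - - X w]funext do rewrite opprK.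
Qed.

(** The integrand is at most [c] on [0, K]; beyond [K] it is at most the tail of [truncate X K]. *)
Lemma upper_min_le X (c K : R) : measurable_fun setT X -> 0 <= c -> 0 <= K ->
  (upper (Num.min c) (fun w => `|X w|)%R <=
   (c * K)%:E + 'E_P[truncate X K])%E.
Proof.
move=> mX c0 K0; have mY := measurable_truncate K mX.
have mXn : measurable_fun setT (fun w => `|X w|) by exact: measurableT_comp.
rewrite expectation_upper//; last by move=> w; exact: truncate_ge0.
(* Writing [c * K] as an integral reduces the claim to a pointwise comparison. *)
have <- : (\int[lebesgue_measure]_(x in `[0%R, +oo[)
    (c%:E * (\1_(`[0%R, K] : set R) x)%:E) = (c * K)%:E)%E.
  rewrite ge0_integralZl_EFin//; last first.
    by apply/measurable_EFinP; exact: measurable_indic.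
  rewrite integral_indic// EFinM; congr (_ * _)%E.
  transitivity (lebesgue_measure (`[0%R, K]%classic : set R)).
    congr lebesgue_measure; apply: setIidl => x.
    by rewrite /= !in_itv/= andbT => /andP[].
  rewrite lebesgue_measure_itv/= lte_fin.
  by case: ltgtP K0 => // [_|<-] _; rewrite ?sube0.
rewrite -ge0_integralD//; first last.
- by apply/measurable_EFinP; exact: measurable_tail.
- by move=> x _; rewrite lee_fin; have /andP[] := tail_ge0_le1 P x mY.
- apply/measurable_EFinP/measurable_funM => //.
- by move=> x _; rewrite -EFinM lee_fin mulr_ge0.
apply: ge0_le_integral => //=.
- move=> x _; rewrite lee_fin le_min c0.
  by have /andP[] := tail_ge0_le1 P x mXn.
- by apply/measurable_EFinP/measurable_minr => //; exact: measurable_tail.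
- apply: emeasurable_funD.
    exact/measurable_EFinP/measurable_funM.
  by apply/measurable_EFinP; exact: measurable_tail.
- move=> x; rewrite in_itv/= andbT => x0; rewrite -EFinM -EFinD lee_fin ge_min.
  have /andP[t0 _] := tail_ge0_le1 P x mY.
  rewrite indicE; have [xK|xK] := leP x K.
    by rewrite mem_set ?mulr1 ?lerDl ?t0//= in_itv/= x0.
  rewrite memNset; last by rewrite /= in_itv/= x0/= leNgt xK.
  rewrite mulr0 add0r.
  apply/orP; right; apply: le_tail => // w xX.
  by rewrite /truncate indicE mem_set ?mulr1//= (lt_trans xK).
Qed.

(** Nonnegativity allows exchanging series and integral. *)
Lemma upper_weight_distortion_le (w : nat -> R) X :
  (forall n, 0 < w n) -> (\sum_(n <oo) (w n)%:E <= 1)%E ->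
  measurable_fun setT X ->
  (upper (weight_distortion w) X <=
   upper id X + \sum_(n <oo) upper (Num.min (w n)) X)%E.
Proof.
move=> w0 w1 mX; have [dh _ _] := weight_distortion_c w0 w1.
have tX0 x : 0 <= tail X x by have /andP[] := tail_ge0_le1 P x mX.
have min0 n x : (0 <= (Num.min (w n) (tail X x))%:E)%E.
  by rewrite lee_fin le_min tX0 ltW.
pose D : set (measurableTypeR R) := `[0%R, +oo[%classic.
have mD : measurable D by exact: measurable_itv.
have mmin n : measurable_fun D (fun x => (Num.min (w n) (tail X x))%:E).
  by apply/measurable_EFinP/measurable_minr => //; exact: measurable_tail.
have msum : measurable_fun D
    (fun x => (\sum_(n <oo) (Num.min (w n) (tail X x))%:E)%E).
  exact: (@ge0_emeasurable_sum _ _ _ D _ xpredT).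
rewrite /upper -integral_nneseries//.
rewrite -ge0_integralD//; first last.
- by move=> x _; apply: nneseries_ge0.
- by apply/measurable_EFinP; exact: measurable_tail.
- by move=> x _; rewrite lee_fin.
apply: ge0_le_integral => //=.
- by move=> x _; rewrite lee_fin; have /andP[] := distortion_tail P x dh mX.
- by apply/measurable_EFinP; exact: measurable_distortion_tail.
- apply: emeasurable_funD => //.
  by apply/measurable_EFinP; exact: measurable_tail.
- by move=> x _; exact: weight_distortion_le.
Qed.

Lemma uniformly_integrable_upper S :
  (forall X, S X -> measurable_fun setT X) -> uniformly_integrable P S ->
  exists2 h, distortion_c h & exists M : R, forall X, S X ->
    (upper h (fun w => `|X w|)%R <= M%:E)%E.
Proof.
move=> mS /uniformly_integrableP ui.
have half0 n : 0 < 1 / (2 ^ n.+1)%:R :> R by rewrite divr_gt0// ltr0n expn_gt0.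
have /choice[K HK] : forall n, exists K : R, 0 <= K /\ forall X, S X ->
    ('E_P[truncate X K] <= (1 / (2 ^ n.+1)%:R)%:E)%E.
  move=> n; have : \forall K \near +oo, (0 <= K :> R) /\ forall X, S X ->
      ('E_P[truncate X K] <= (1 / (2 ^ n.+1)%:R)%:E)%E.
    apply: filterS2 (nbhs_pinfty_ge (num_real 0)) (ui _ (half0 n)).
    by move=> x; split.
  by move=> /filter_ex.
(* Dividing by [1 + K n] keeps both [w n] and [w n * K n] below 2^-(n+1), even when [K n] is 0. *)
pose w n := 1 / (2 ^ n.+1)%:R / (1 + K n).
have K0 n : 0 <= K n by have [] := HK n.
have K1 n : 0 < 1 + K n by rewrite ltr_wpDr.
have w0 n : 0 < w n by rewrite divr_gt0.
have w1 : (\sum_(n <oo) (w n)%:E <= 1)%E.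
  apply: le_trans (epsilon_trick0 xpredT (@ler01 R)).
  apply: lee_nneseries => n *; first by rewrite lee_fin ltW.
  by rewrite lee_fin ler_pdivrMr// ler_peMr ?lerDl// ltW.
exists (weight_distortion w); first exact: weight_distortion_c.
(* The first two terms bound E|X| using level [K 0]; the 2 bounds the series. *)
exists (1 * K 0 + 1 / (2 ^ 1)%:R + 2) => X SX.
have mX := mS X SX.
have mXn : measurable_fun setT (fun w => `|X w|) by exact: measurableT_comp.
rewrite (le_trans (upper_weight_distortion_le w0 w1 mXn))// EFinD.
apply: leeD.
  (* Tails are at most 1, so [upper_min_le] applies with [c = 1]. *)
  rewrite [leLHS](_ : _ = upper (Num.min 1) (fun w => `|X w|)); last first.
    apply: eq_integral => x _; congr (_%:E); apply/esym/min_idPr.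
    by have /andP[] := tail_ge0_le1 P x mXn.
  rewrite (le_trans (upper_min_le mX ler01 (K0 0)))// EFinD leeD2l//.
  by have [_] := HK 0; exact.
apply: le_trans (epsilon_trick0 xpredT (@ler0n R 2)).
apply: lee_nneseries => n *.
  by apply: integral_ge0 => x _; rewrite lee_fin le_min ltW//=;
    have /andP[] := tail_ge0_le1 P x mXn.
rewrite (le_trans (upper_min_le mX (ltW (w0 n)) (K0 n)))//.
(* One share pays for [w n * K n], the other for the truncated expectation. *)
rewrite (_ : 2 / _ = 1 / (2 ^ n.+1)%:R + 1 / (2 ^ n.+1)%:R); last first.
  by rewrite -mulrDl.
rewrite EFinD; apply: leeD; last by have [_] := HK n; exact.
by rewrite lee_fin /w mulrAC ler_pdivrMr// ler_wpM2l// ?lerDr// ltW.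
Qed.

End bounds.

Theorem theorem4p2 (d : measure_display) (T : measurableType d) (R : realType)
    (P : probability T R) (P_atomless : atomless P)
    (S : set (T -> R)) (S_L1 : S `<=` [set X | X \in Lfun P 1]) :
  [<-> uniformly_integrable P S;
       exists2 h : R -> R, distortion_c h &
         bounded_values S (fun X => rho P h (fun w => `|X w|));
       exists2 h : R -> R, distortion_c h &
         bounded_values S (fun X => rho P h X) /\
         bounded_values S (fun X => rho P h (fun w => - X w))].
Proof.
have mS X : S X -> measurable_fun setT X by move=> /S_L1/Lfun1_measurable.
have mSn X : S X -> measurable_fun setT (fun w => `|X w|).
  by move=> /mS mX; exact: measurableT_comp.
tfae.
- move=> /(uniformly_integrable_upper mS)[h hc [M HM]]; exists h => //.
  have [dh _ _] := hc; apply/bounded_valuesP; exists M => X SX.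
  have mXn := mSn X SX.
  by rewrite rho_ge0// gee0_abs; [exact: HM|exact: upper_ge0].
- move=> [h hc /bounded_valuesP[M HM]]; have [dh ch _] := hc.
  have rhoM X : S X -> (rho P h (fun w => `|X w|)%R <= M%:E)%E.
    by move=> SX; rewrite (le_trans (lee_abs _))//; exact: HM.
  exists h => //; split; apply/bounded_valuesP; exists M => X SX.
    by rewrite (le_trans (le_abse_rho P dh ch (mS X SX)))// rhoM.
  have mNX : measurable_fun setT (fun w => - X w).
    by apply: measurableT_comp => //; exact: mS.
  rewrite (le_trans (le_abse_rho P dh ch mNX))//.
  by under [fun w => `|- X w|]funext do rewrite normrN; exact: rhoM.
(* The same [h] serves: the two one-sided bounds control [upper h] of |X|, which yields uniform
   integrability. *)
- move=> [h hc [/bounded_valuesP[M1 H1] /bounded_valuesP[M2 H2]]].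
  apply: (upper_bounded_uniformly_integrable hc mS).
  pose M := Num.max M1 M2.
  eexists => X SX; apply: (@two_sided_upper_bound _ _ _ _ h X M) => //.
  + exact: S_L1.
  + rewrite (le_trans (lee_abs _))// (le_trans (H1 X SX))//.
    by rewrite lee_fin le_max lexx.
  + rewrite (le_trans (lee_abs _))// (le_trans (H2 X SX))//.
    by rewrite lee_fin le_max lexx orbT.
Qed.
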